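(* Let $n$ be a positive integer and let $T$ be a sub-$n$-normal operator on a Hilbert space $\mathcal{H}$. If $T^{m}$ is $n$-quasinormal for an integer $m>1$, then $T$ is $n$-quasinormal.
   Context: Hilbert spaces are separable and complex, and operators are bounded and linear. An operator $S$ is $n$-normal if $S^*S^n=S^nS^*$; equivalently, $S^n$ is normal. An operator $T\in B(\mathcal{H})$ is sub-$n$-normal if there exist a Hilbert space $\mathcal{K}$ containing $\mathcal{H}$ and an $n$-normal operator $S\in B(\mathcal{K})$ such that $S\mathcal{H}\subseteq\mathcal{H}$ and $T=S|_{\mathcal{H}}$. An operator $A$ is quasinormal if $A$ commutes with $A^*A$. An operator $A$ is $n$-quasinormal if $A^n$ is quasinormal, i.e. $A^n$ commutes with $A^{*n}A^n$. *)

(* Defs.v *)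
From HB Require Import structures.
From mathcomp Require Import all_boot all_order all_algebra sesquilinear.
From mathcomp Require Import complex ring lra.
From mathcomp Require Import boolp classical_sets functions cardinality reals.
From mathcomp Require Import topology normedtype.

Set Implicit Arguments.
Unset Strict Implicit.
Unset Printing Implicit Defensive.

Import Order.TTheory GRing.Theory Num.Theory.
Import numFieldNormedType.Exports.

Local Open Scope classical_set_scope.
Local Open Scope ring_scope.

(* Separable complex Hilbert spaces, with scalars R[i]. The form [inner] is    *)
(* linear in its first argument and conjugate-linear in its second; norms are *)
(* R[i]-valued, as always in a normed module over R[i].                       *)
HB.mixin Record CompleteNormedModule_isHilbert (R : realType) H
    & CompleteNormedModule R[i] H := {
  inner : {dot H for Num.conj} ;
  normr_inner : forall x : H, `|x| ^+ 2 = inner x x ;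
  hilbert_separable : exists2 D : set H, countable D & dense D
}.

#[short(type="hilbertType")]
HB.structure Definition Hilbert (R : realType) :=
  {H of CompleteNormedModule R[i] H & CompleteNormedModule_isHilbert R H}.

Arguments inner {R s}.
Notation "''[' x , y ]" := (inner x y) : ring_scope.

Record bounded_op (R : realType) (H K : hilbertType R) := BoundedOp {
  op_fun :> {linear H -> K} ;
  op_bounded : exists M : R, forall x, `|op_fun x| <= M%:C%C * `|x|
}.

Section InnerTheory.
Variables (R : realType) (H : hilbertType R).
Implicit Types (x y z : H) (a : R[i]).
Local Notation Re := (@complex.Re R).

Let ReB (a b : R[i]) : Re (a - b) = Re a - Re b.
Proof. by case: a b => [? ?] [? ?]. Qed.

Let ReD (a b : R[i]) : Re (a + b) = Re a + Re b.
Proof. by case: a b => [? ?] [? ?]. Qed.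

Let ReN (a : R[i]) : Re (- a) = - Re a.
Proof. by case: a. Qed.

Let ReZ (t : R) (a : R[i]) : Re (t%:C%C * a) = t * Re a.
Proof. by case: a => u v /=; rewrite mul0r subr0. Qed.

Let ReJ (a : R[i]) : Re a^* = Re a.
Proof. by case: a. Qed.

Let ge0_ReE (a : R[i]) : 0 <= a -> a = (Re a)%:C%C.
Proof. by move=> a0; rewrite RRe_real // ger0_real. Qed.

Lemma innerDl x y z : '[x + y, z] = '[x, z] + '[y, z].
Proof. exact: linearDl. Qed.

Lemma innerDr x y z : '[x, y + z] = '[x, y] + '[x, z].
Proof. exact: linearDr. Qed.

Lemma innerBl x y z : '[x - y, z] = '[x, z] - '[y, z].
Proof. exact: linearBl. Qed.

Lemma innerBr x y z : '[x, y - z] = '[x, y] - '[x, z].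
Proof. exact: linearBr. Qed.

Lemma innerZl a x y : '[a *: x, y] = a * '[x, y].
Proof. by rewrite linearZl_LR. Qed.

Lemma innerZr a x y : '[x, a *: y] = a^* * '[x, y].
Proof. by rewrite linearZr_LR. Qed.

Lemma innerC x y : '[x, y] = '[y, x]^*.
Proof. by rewrite hermC expr0 mul1r. Qed.

Lemma innerxx_ge0 x : 0 <= '[x, x].
Proof. exact: dnorm_ge0. Qed.

Lemma innerxx_eq0 x : '[x, x] = 0 -> x = 0.
Proof. by move/eqP; rewrite dnorm_eq0 => /eqP. Qed.

Lemma inner_injr x y : (forall z, '[z, x] = '[z, y]) -> x = y.
Proof.
move=> xy; apply/eqP; rewrite -subr_eq0; apply/eqP/innerxx_eq0.
by rewrite innerBr xy subrr.
Qed.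

Lemma inner_le_norm x y : `|'[x, y]| <= `|x| * `|y|.
Proof.
rewrite -(@ler_pXn2r _ 2) ?nnegrE ?mulr_ge0 // exprMn !normr_inner.
have [->|y0] := eqVneq y 0; first by rewrite !linear0r normr0 expr0n mulr0.
set c := '[x, y]; set n := '[y, y].
have n0 : 0 < n by rewrite dnorm_gt0.
have nJ : n^* = n by rewrite geC0_conj // ltW.
have := innerxx_ge0 (n *: x - c *: y).
rewrite innerBl !innerBr !innerZl !innerZr nJ -/n -/c (innerC y x) -/c.
rewrite [X in 0 <= X](_ : _ = n * ('[x, x] * n - c * c^*)); last by ring.
by rewrite pmulr_rge0 // subr_ge0 -normCK.
Qed.

(* The representing vector is the minimizer of x |-> `|x| ^+ 2 - 2 Re (f x).   *)
Lemma riesz_representation (f : {scalar H}) :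
  (exists M : R, forall x, `|f x| <= M%:C%C * `|x|) ->
  exists z, forall x, f x = '[x, z].
Proof.
move=> [M fM].
pose q x := Re '[x, x]; pose J x := q x - 2 * Re (f x); pose N x := Re `|x|.
have qE x : '[x, x] = (q x)%:C%C by rewrite -ge0_ReE // innerxx_ge0.
have NE x : `|x| = (N x)%:C%C by rewrite -ge0_ReE.
have N0 x : 0 <= N x by rewrite -ler0c -NE normr_ge0.
have Nq x : q x = N x ^+ 2.
  by apply: complexI; rewrite rmorphXn /= -NE normr_inner qE.
have q0 x : 0 <= q x by rewrite Nq sqr_ge0.
have ReN' x y : `|Re '[x, y]| <= N x * N y.
  by rewrite -lecR rmorphM /= -!NE (le_trans (normc_ge_Re _)) // inner_le_norm.
have JD x w : J (x + w) = J x + q w + 2 * Re '[w, x] - 2 * Re (f w).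
  by rewrite /J /q (linearD f) innerDl !innerDr !ReD (innerC x w) ReJ; ring.
have qN h : q (- h) = q h by rewrite /q linearNl linearNr opprK.
have JB m h : J (m + h) + J (m - h) = 2 * J m + 2 * q h.
  by rewrite !JD qN (linearN f) linearNl !ReN; ring.
have Jlb x : - M ^+ 2 <= J x.
  have : Re (f x) <= M * N x.
    rewrite -lecR rmorphM /= -NE (le_trans _ (fM x)) //.
    by rewrite (le_trans _ (normc_ge_Re _)) // lecR ler_norm.
  rewrite /J Nq; have := sqr_ge0 (N x - M); nra.
have Jinf : has_inf (range J).
  split; first by exists (J 0), 0.
  by exists (- M ^+ 2) => _ [x _ <-].
pose d := inf (range J).
have dJ x : d <= J x by apply: ge_inf; [exact: Jinf.2|exists x].
have Jd e : 0 < e -> exists x, J x < d + e.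
  by move=> e0; have [_ [x _ <-] ?] := inf_adherent e0 Jinf; exists x.
pose F := filter_from [set e : R | 0 < e] (fun e => [set x | J x < d + e]).
have FF : ProperFilter F.
  apply: filter_from_proper => [|e e0]; last by have [x] := Jd e e0; exists x.
  apply: filter_from_filter => [|e1 e2 e10 e20]; first by exists 1 => /=.
  exists (Num.min e1 e2) => /= [|x /= ]; first by rewrite lt_min e10.
  by move=> xd; split; apply: lt_le_trans xd _; rewrite lerD2l ge_min lexx ?orbT.
have /cauchy_cvg : cauchy F.
  apply: cauchy_exP => e e0.
  have eE : e = (Re e)%:C%C by apply: ge0_ReE; rewrite ltW.
  have r0 : 0 < Re e by rewrite -ltcR -eE.
  set r := Re e in eE r0.
  pose t := r ^+ 2 / 4.
  have t0 : 0 < t by rewrite /t; nra.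
  have [x0 x0d] := Jd t t0; exists x0; exists t => //= y /= yd.
  rewrite -ball_normE /= eE NE ltcR.
  rewrite -(@ltr_pXn2r _ 2) ?nnegrE ?(ltW r0) // -Nq.
  pose m := (2^-1 : R[i]) *: (x0 + y); pose h := (2^-1 : R[i]) *: (x0 - y).
  have half u : u = (2^-1 : R[i]) *: u + (2^-1 : R[i]) *: u.
    by rewrite -scalerDl -[2^-1]mul1r -splitr scale1r.
  have x0E : m + h = x0.
    by rewrite /m /h -scalerDr addrACA subrr addr0 scalerDr -half.
  have yE : m - h = y.
    by rewrite /m /h -scalerBr opprD addrACA subrr add0r opprK scalerDr -half.
  have -> : q (x0 - y) = 4 * q h.
    have -> : x0 - y = h + h by rewrite /h -half.
    by rewrite /q innerDl !innerDr !ReD; ring.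
  have := JB m h; rewrite x0E yE; have := dJ m; rewrite /t in x0d yd; lra.
move=> /cvg_ex[z Fz]; exists z.
have key w : 0 <= q w + 2 * Re '[w, z] - 2 * Re (f w).
  rewrite leNgt; apply/negP; set v := (X in X < 0) => v0.
  pose t := - v / (2 * (1 + 2 * N w)).
  have Nw := N0 w.
  have t0 : 0 < t by rewrite divr_gt0 //; lra.
  have [x [/= xd zx]] : exists x, J x < d + t /\ N (z - x) < t.
    have F1 : F [set x | J x < d + t] by exists t.
    have F2 : F [set x | N (z - x) < t].
      apply: Fz; apply/nbhs_ballP; exists t%:C%C; first by rewrite /= ltcR.
      by move=> x; rewrite -ball_normE /= NE ltcR.
    by have [x [? ?]] := filter_ex (filterI F1 F2); exists x.
  have := dJ (x + w); rewrite JD.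
  have -> : '[w, x] = '[w, z] - '[w, z - x] by rewrite innerBr; ring.
  rewrite ReB; have := ReN' w (z - x); rewrite ler_norml => /andP[+ _].
  have vt : - v = t * (2 * (1 + 2 * N w)) by rewrite /t divfK //; lra.
  have := ler_wpM2l Nw (ltW zx); move: vt; rewrite /v; nra.
move=> w; apply/eqP; rewrite -subr_eq0; apply/negPn/negP => g0.
set g := f w - '[w, z] in g0.
pose t := (q w + 1)^-1.
have q1 : 0 < q w + 1 by rewrite ltr_wpDl.
have t0 : 0 < t by rewrite invr_gt0.
have qt : t * (q w + 1) = 1 by rewrite mulVf // gt_eqF.
pose G := Re (g^* * g).
have GE : g^* * g = G%:C%C by apply: ge0_ReE; rewrite mulrC mul_conjC_ge0.
have G0 : 0 < G by rewrite -ltcR -GE mulrC mul_conjC_gt0.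
have tJ : (t%:C%C)^* = t%:C%C by rewrite conj_Creal // complex_real.
have := key ((t%:C%C * g^*) *: w).
have -> : q ((t%:C%C * g^*) *: w) = t * (t * (G * q w)).
  rewrite /q innerZl innerZr rmorphM /= conjCK tJ.
  rewrite [X in Re X](_ : _ = t%:C%C * (t%:C%C * ((g^* * g) * '[w, w]))).
    by rewrite GE !ReZ.
  by ring.
rewrite (linearZ_LR f) innerZl /= -addrA -mulrBr -ReB -mulrBr.
have -> : '[w, z] - f w = - g by rewrite /g opprB.
rewrite -mulrA mulrN ReZ GE ReN /=.
have -> : t * (t * (G * q w)) + 2 * (t * - G) = t * G * (t * q w - 2) by ring.
rewrite pmulr_rge0 ?mulr_gt0 //; lra.
Qed.

End InnerTheory.

Section BoundedOperators.
Variable R : realType.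
Implicit Types H K L : hilbertType R.

Lemma bounded_op_ext H K (S T : bounded_op H K) : S =1 T -> S = T.
Proof.
case: S T => [[f [[af] [lf]]] bf] [[g [[ag] [lg]]] bg] /= fg.
have {}fg : f = g by apply/funext.
subst g; have eqa : af = ag by exact: Prop_irrelevance.
have eql : lf = lg by exact: Prop_irrelevance.
subst ag lg; congr BoundedOp; exact: Prop_irrelevance.
Qed.

Lemma op_id_bounded H :
  exists M : R, forall x : H, `|idfun x| <= M%:C%C * `|x|.
Proof. by exists 1 => x; rewrite rmorph1 mul1r. Qed.

Definition op_id H : bounded_op H H := BoundedOp (op_id_bounded H).

Lemma op_comp_bounded H K L (S : bounded_op K L) (T : bounded_op H K) :
  exists M : R, forall x, `|(S \o T) x| <= M%:C%C * `|x|.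
Proof.
have [[M SM] [N TN]] := (op_bounded S, op_bounded T).
exists (`|M| * N) => x; rewrite rmorphM /= -mulrA.
have /le_trans -> // : `|S (T x)| <= `|M|%:C%C * `|T x|.
  by apply: le_trans (SM _) _; rewrite ler_wpM2r // lecR ler_norm.
by rewrite ler_wpM2l // ler0c.
Qed.

Definition op_comp H K L (S : bounded_op K L) (T : bounded_op H K) :
  bounded_op H L := BoundedOp (op_comp_bounded S T).

Definition op_exp H (T : bounded_op H H) (n : nat) : bounded_op H H :=
  iter n (op_comp T) (op_id H).

Lemma adjoint_exists H K (T : bounded_op H K) :
  exists S : bounded_op K H, forall x y, '[T x, y] = '[x, S y].
Proof.
have [M TM] := op_bounded T.
have TM' x : `|T x| <= `|M|%:C%C * `|x|.
  by apply: le_trans (TM _) _; rewrite ler_wpM2r // lecR ler_norm.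
have /choice[S ST] : forall y, exists z, forall x, '[T x, y] = '[x, z].
  move=> y.
  have Tyl : scalar (fun x => '[T x, y]).
    by move=> a u v; rewrite linearP innerDl innerZl.
  pose f : {scalar H} := HB.pack (fun x => '[T x, y])
    (GRing.isLinear.Build _ _ _ _ _ Tyl).
  apply: (riesz_representation (f := f)); exists (`|M| * complex.Re `|y|) => x.
  rewrite /f /= (le_trans (inner_le_norm _ _)) // rmorphM /=.
  by rewrite RRe_real ?ger0_real // mulrAC ler_wpM2r.
have Sl : linear S.
  move=> a u v; apply: inner_injr => x.
  by rewrite -ST !innerDr !innerZr -!ST.
pose S' : {linear K -> H} := HB.pack S (GRing.isLinear.Build _ _ _ _ _ Sl).
suff SM : exists N : R, forall y, `|S' y| <= N%:C%C * `|y|.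
  by exists (BoundedOp SM).
exists `|M| => y; rewrite /S' /=.
have [->|Sy0] := eqVneq (S y) 0; first by rewrite normr0 mulr_ge0 // ler0c.
rewrite -(@ler_pM2r _ `|S y|) ?normr_gt0 // -expr2 normr_inner -ST.
rewrite -[X in X <= _]ger0_norm ?ST ?innerxx_ge0 // -ST.
apply: le_trans (inner_le_norm _ _) _.
by rewrite mulrAC ler_wpM2r.
Qed.

Definition adjoint H K (T : bounded_op H K) : bounded_op K H :=
  projT1 (cid (adjoint_exists T)).

Lemma adjointP H K (T : bounded_op H K) x y : '[T x, y] = '[x, adjoint T y].
Proof. exact: projT2 (cid (adjoint_exists T)) x y. Qed.

End BoundedOperators.

Section OperatorClasses.
Variable R : realType.

Definition n_normal (n : nat) (K : hilbertType R) (S : bounded_op K K) : Prop :=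
  op_comp (adjoint S) (op_exp S n) = op_comp (op_exp S n) (adjoint S).

(* The inclusion of H into K is an inner-product preserving linear map J, and *)
(* S (J x) = J (T x) says that S leaves J(H) invariant and restricts to T.    *)
Definition sub_n_normal (n : nat) (H : hilbertType R) (T : bounded_op H H) :
    Prop :=
  exists (K : hilbertType R) (J : {linear H -> K}) (S : bounded_op K K),
    [/\ forall x y, '[J x, J y] = '[x, y],
        n_normal n S &
        forall x, S (J x) = J (T x)].

Definition quasinormal (H : hilbertType R) (A : bounded_op H H) : Prop :=
  op_comp A (op_comp (adjoint A) A) = op_comp (op_comp (adjoint A) A) A.

Definition n_quasinormal (n : nat) (H : hilbertType R) (A : bounded_op H H) :
    Prop :=
  quasinormal (op_exp A n).

End OperatorClasses.

(* Main.v *)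
Require Import Defs.
From mathcomp Require Import all_boot all_order all_algebra reals.
From mathcomp Require Import complex ring lra.

Set Implicit Arguments.
Unset Strict Implicit.
Unset Printing Implicit Defensive.

Import Order.TTheory GRing.Theory Num.Theory.
Local Open Scope ring_scope.

(** Let S be an n-normal extension of T, and put A = T^n and N = S^n. The
operator N is normal and extends A, and A^m = (T^m)^n is quasinormal, so the
claim is that a subnormal m-th root A of a quasinormal operator is quasinormal
([subnormal_root_quasinormal]).

Let V be the inclusion of the space of A into that of N, and Q = N*N, which
commutes with N. Since N is normal, |N^k V x|^2 = <Q^k V x, V x> for all k.
For C = A^m, quasinormality says C*C*CC = (C*C)^2, and in terms of Q this reads
<Q^(2m) V x, V x> = |V* Q^m V x|^2, that is, |Q^m V x| = |V* Q^m V x|: the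
projection onto the range of V does not shorten Q^m V x. Hence the range of V is
invariant under Q^m. If it is invariant under Q as well, then A*A is the
restriction of Q, and A commutes with it because N commutes with Q.

It remains to go from Q^m to its positive root Q ([positive_root_invariant]).
After scaling, 0 <= Q <= 1, and Q is approximated by polynomials in Q^m, namely
the Newton-like iterates q_(k+1) = q_k + (t^m - q_k^m) / m at t = Q. A spectral
theorem is avoided by proving the error estimates algebraically, in the semiring
of polynomials sum a_ij t^i (1 - t)^j with a_ij >= 0. Each of its elements is
manifestly a positive operator at t = Q ([bernstein_pos]), and the estimate
k (t - q_k)^m <= m holds in the order it defines ([root_approx_error]). The
Cauchy-Schwarz inequality turns this into strong convergence of q_k(Q) to Q
along a subsequence ([vanishing_descent]). *)

(** * Approximating a root inside an ordered semiring *)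

(** With c = 1/m, an iteration increasing to t that uses t only through t^m. *)
Fixpoint root_approx (A : comNzRingType) (c t : A) (m k : nat) : A :=
  if k is k'.+1 then
    root_approx c t m k' + c * (t ^+ m - root_approx c t m k' ^+ m)
  else 0.

(** The cone [C] plays the role of the nonnegative elements: a is at most b
when [C (b - a)]. *)
Section RootApproximation.
Variables (A : comNzRingType) (C : A -> Prop).
Hypotheses (C0 : C 0) (C1 : C 1).
Hypothesis CD : forall a b, C a -> C b -> C (a + b).
Hypothesis CM : forall a b, C a -> C b -> C (a * b).

Lemma cone_exp a i : C a -> C (a ^+ i).
Proof.
by move=> Ca; elim: i => [|i IH]; rewrite ?expr0 // exprS; apply: CM.
Qed.

Lemma cone_nat i : C i%:R.
Proof. by elim: i => [//|i IH]; rewrite -addn1 natrD; apply: CD. Qed.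

Lemma cone_sum n (F : 'I_n -> A) : (forall i, C (F i)) -> C (\sum_i F i).
Proof. by move=> CF; elim/big_ind: _. Qed.

Lemma cone_1BM a b : C a -> C (1 - a) -> C (1 - b) -> C (1 - a * b).
Proof.
move=> Ca C1a C1b; have -> : 1 - a * b = (1 - a) + a * (1 - b) by ring.
by apply: CD => //; apply: CM.
Qed.

Lemma cone_1BX a i : C a -> C (1 - a) -> C (1 - a ^+ i).
Proof.
move=> Ca C1a; elim: i => [|i IH]; first by rewrite expr0 subrr.
by rewrite exprS; apply: cone_1BM.
Qed.

Lemma cone_subrXX a b i : C a -> C b -> C (a - b) -> C (a ^+ i - b ^+ i).
Proof.
move=> Ca Cb Cab; rewrite subrXX; apply: CM => //; apply: cone_sum => j.
by apply: CM; apply: cone_exp.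
Qed.

Variables (c t : A) (m : nat).
Hypotheses (Cc : C c) (Ct : C t) (C1t : C (1 - t)) (cm : c * m.+1%:R = 1).
Local Notation q := (root_approx c t m.+1).

(** With e = t - q and g the sum of the t^(m-i) q^i for i <= m, one step
subtracts c e g from e; here 1 - c g is an average of the 1 - t^(m-i) q^i, so
e stays in the cone. As g dominates t^m, each step adds at least e t^m to
(m+1) q, and e decreases, whence the last bound. *)
Lemma root_approx_bounds k :
  [/\ C (q k), C (t - q k) & C (m.+1%:R * q k - k%:R * (t - q k) * t ^+ m)].
Proof.
elim: k => [|k [Cq Ce Ck]]; first by rewrite /= subr0 mulr0 !mul0r subrr; split.
rewrite /=; set s := q k in Cq Ce Ck *.
have C1s : C (1 - s).
  have -> : 1 - s = (1 - t) + (t - s) by ring.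
  exact: CD.
rewrite subrXX /=.
set g := \sum_(i < m.+1) _.
have Cg : C g by apply: cone_sum => i; apply: CM; apply: cone_exp.
have Cgt : C (g - t ^+ m).
  (* The term i = 0 of g is t^m. *)
  rewrite /g big_ord_recl /= subn0 expr0 mulr1 [X in C X]addrC addKr.
  by apply: cone_sum => i; apply: CM; apply: cone_exp.
have C1cg : C (1 - c * g).
  have -> : 1 - c * g = c * \sum_(i < m.+1) (1 - t ^+ (m - i) * s ^+ i).
    by rewrite sumrB big_const_ord iter_addr_0 mulrBr cm.
  apply: CM => //; apply: cone_sum => i.
  by apply: cone_1BM; [apply: cone_exp | apply: cone_1BX | apply: cone_1BX].
split.
- by apply: CD => //; apply: CM => //; apply: CM.
- have -> : t - (s + c * ((t - s) * g)) = (t - s) * (1 - c * g) by ring.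
  exact: CM.
- (* The last summand vanishes by cm; it lets ring treat c as free. *)
  have -> : m.+1%:R * (s + c * ((t - s) * g))
      - k.+1%:R * (t - (s + c * ((t - s) * g))) * t ^+ m
    = (m.+1%:R * s - k%:R * (t - s) * t ^+ m) + (t - s) * (g - t ^+ m)
      + k.+1%:R * c * (t - s) * g * t ^+ m
      + (c * m.+1%:R - 1) * (t - s) * g.
    by rewrite -[k.+1]addn1 natrD; ring.
  rewrite cm subrr !mul0r addr0.
  apply: CD; first by apply: CD => //; apply: CM.
  apply: CM; last exact: cone_exp.
  by do 3![apply: CM => //]; apply: cone_nat.
Qed.

(** The error e is at most t, so e^(m+1) <= e t^m, and k e t^m <= (m+1) q is
at most m+1. *)
Lemma root_approx_error k : C (m.+1%:R - k%:R * (t - q k) ^+ m.+1).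
Proof.
have [Cq Ce Ck] := root_approx_bounds k; set s := q k in Cq Ce Ck *.
have -> : m.+1%:R - k%:R * (t - s) ^+ m.+1
  = m.+1%:R * (1 - t) + m.+1%:R * (t - s)
    + (m.+1%:R * s - k%:R * (t - s) * t ^+ m)
    + k%:R * (t - s) * (t ^+ m - (t - s) ^+ m).
  by rewrite exprS; ring.
have Cn := cone_nat.
apply: CD.
  by apply: CD => //; apply: CD; apply: CM.
apply: CM; first exact: CM.
by apply: cone_subrXX => //; rewrite subKr.
Qed.

End RootApproximation.

(** * Polynomials with nonnegative Bernstein coefficients *)

(** Closure under products is derived ([bernsteinM]) and not built in: it is a
syntactic fact here, whereas a product of commuting positive operators is not
evidently positive. *)
Inductive bernstein_cone (F : numFieldType) : {poly F} -> Prop :=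
| Bernstein_gen a i j of 0 <= a : bernstein_cone (a *: ('X^i * (1 - 'X) ^+ j))
| Bernstein_add p r of bernstein_cone p & bernstein_cone r :
    bernstein_cone (p + r).

Section BernsteinCone.
Variable F : numFieldType.
Local Notation B := (@bernstein_cone F).

Lemma bernstein_const (a : F) : 0 <= a -> B a%:P.
Proof.
by move=> a0; have := Bernstein_gen 0 0 a0; rewrite !expr0 mulr1 alg_polyC.
Qed.

Lemma bernsteinM p r : B p -> B r -> B (p * r).
Proof.
elim=> [a i j a0|p1 p2 _ IH1 _ IH2] Br; last first.
  by rewrite mulrDl; apply: Bernstein_add; [apply: IH1 | apply: IH2].
elim: Br => [b k l b0|r1 r2 _ IH1 _ IH2]; last first.
  by rewrite mulrDr; apply: Bernstein_add.
rewrite -scalerAl -scalerAr scalerA mulrACA -!exprD.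
by apply: Bernstein_gen; rewrite mulr_ge0.
Qed.

Lemma bernstein_X : B 'X.
Proof.
by have := Bernstein_gen 1 0 (@ler01 F); rewrite scale1r expr0 mulr1.
Qed.

Lemma bernstein_1BX : B (1 - 'X).
Proof.
by have := Bernstein_gen 0 1 (@ler01 F); rewrite scale1r expr0 mul1r.
Qed.

End BernsteinCone.

(** * Polynomials in a linear endomorphism *)

Section PolynomialCalculus.
Variables (F : fieldType) (V : lmodType F) (Q : {linear V -> V}).

Definition poly_op (p : {poly F}) (x : V) : V :=
  \sum_(i < size p) p`_i *: iter i Q x.

Lemma poly_op_wide n (p : {poly F}) x :
  (size p <= n)%N -> poly_op p x = \sum_(i < n) p`_i *: iter i Q x.
Proof.
move=> pn; rewrite /poly_op (big_ord_widen n (fun i => p`_i *: iter i Q x)) //.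
rewrite big_mkcond; apply: eq_bigr => i _; case: ltnP => // pi.
by rewrite nth_default // scale0r.
Qed.

Lemma poly_opD p r x : poly_op (p + r) x = poly_op p x + poly_op r x.
Proof.
pose n := maxn (size p) (size r).
rewrite (@poly_op_wide n) ?size_polyD // (@poly_op_wide n p) ?leq_maxl //.
rewrite (@poly_op_wide n r) ?leq_maxr // -big_split; apply: eq_bigr => i _.
by rewrite coefD scalerDl.
Qed.

Lemma poly_opZ a p x : poly_op (a *: p) x = a *: poly_op p x.
Proof.
rewrite (poly_op_wide _ (size_scale_leq a p)) scaler_sumr.
by apply: eq_bigr => i _; rewrite coefZ scalerA.
Qed.

Lemma poly_opB p r x : poly_op (p - r) x = poly_op p x - poly_op r x.
Proof. by rewrite poly_opD -[- r]scaleN1r poly_opZ scaleN1r. Qed.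

Lemma poly_opC a x : poly_op a%:P x = a *: x.
Proof.
by rewrite (poly_op_wide _ (size_polyC_leq1 a)) big_ord1 coefC.
Qed.

Lemma poly_op1 x : poly_op 1 x = x.
Proof. by rewrite poly_opC scale1r. Qed.

Lemma poly_opXM p x : poly_op ('X * p) x = Q (poly_op p x).
Proof.
rewrite (@poly_op_wide (size p).+1); last first.
  by rewrite (leq_trans (size_polyMleq _ _)) // size_polyX.
rewrite big_ord_recl coefXM scale0r add0r linear_sum.
by apply: eq_bigr => i _; rewrite coefXM /= linearZ.
Qed.

Lemma poly_opM p r x : poly_op (p * r) x = poly_op p (poly_op r x).
Proof.
elim/poly_ind: p => [|p a IH]; first by rewrite mul0r !poly_opC !scale0r.
rewrite mulrDl !poly_opD mul_polyC poly_opZ poly_opC; congr (_ + _).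
by rewrite [p * 'X]mulrC -mulrA !poly_opXM IH.
Qed.

Lemma poly_opX x : poly_op 'X x = Q x.
Proof. by rewrite -['X]mulr1 poly_opXM poly_op1. Qed.

Lemma poly_opXn n x : poly_op 'X^n x = iter n Q x.
Proof.
by elim: n => [|n IH]; rewrite ?expr0 ?poly_op1 // exprS poly_opXM IH.
Qed.

End PolynomialCalculus.

(** * Positive contractions *)

(** Used with [u j k] = <E_k^(j+1) x, x>: decay of a high power of E_k passes
down to E_k, one exponent at a time. *)
Lemma vanishing_descent (R : realType) (c d : R) (u : nat -> nat -> R) m :
  0 <= c -> (forall j k, u j k ^+ 2 <= c * u j.+1 k) ->
  (forall k, k%:R * u m k <= d) ->
  forall e, 0 < e -> exists k, u 0 k <= e.
Proof.
move=> c0; elim: m u => [|m IH] u uS um e e0.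
  have [k _ dk] : exists2 k, true & d / e < k%:R.
    by exists (Num.truncn (Num.max 0 (d / e))).+1 => //;
       rewrite (le_lt_trans _ (truncnS_gt _)) // le_max lexx orbT.
  exists k; have := um k; have := ler0n R k.
  rewrite ltr_pdivrMr // in dk; nra.
have e1 : 0 < e ^+ 2 / (c + 1) by rewrite divr_gt0 ?exprn_gt0 // ltr_wpDl.
have [k uk] := IH (fun j => u j.+1) (fun j => uS j.+1) um _ e1.
exists k; rewrite leNgt; apply/negP => eu.
move: uk; rewrite ler_pdivlMr ?ltr_wpDl // => uk.
have := uS 0 k; have [u1|u1] := leP 0 (u 1 k); nra.
Qed.

Section PositiveContraction.
Variables (R : realType) (K : hilbertType R) (Q : {linear K -> K}).
Hypothesis Qsym : forall x y, '[Q x, y] = '[x, Q y].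
Hypothesis Q_ge0 : forall x, 0 <= '[Q x, x].
Hypothesis Q_le1 : forall x, '[Q x, x] <= '[x, x].
Local Notation B := (@bernstein_cone R[i]).
Local Notation op := (poly_op Q).

Let pos (p : {poly R[i]}) := forall x, 0 <= '[op p x, x].

(** Even powers of t and 1 - t move to the other side of the inner product,
which leaves the exponents 0 and 1; the mixed case is
t (1 - t) = t^2 (1 - t) + (1 - t)^2 t. *)
Lemma bernstein_gen_pos i j : pos ('X^i * (1 - 'X) ^+ j).
Proof.
have posD p r : pos p -> pos r -> pos (p + r).
  by move=> pp pr x; rewrite poly_opD innerDl addr_ge0.
have posX p : pos p -> pos ('X^2 * p).
  move=> pp x; have -> : 'X^2 * p = 'X * (p * 'X) by ring.
  by rewrite poly_opM poly_opX Qsym poly_opM poly_opX; apply: pp.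
have pos1X p : pos p -> pos ((1 - 'X) ^+ 2 * p).
  move=> pp x; have -> : (1 - 'X) ^+ 2 * p = (1 - 'X) * (p * (1 - 'X)) by ring.
  rewrite poly_opM; set u := op (p * _) x.
  have -> : '[op (1 - 'X) u, x] = '[u, op (1 - 'X) x].
    by rewrite !poly_opB !poly_op1 !poly_opX innerBl innerBr Qsym.
  by rewrite /u poly_opM; apply: pp.
have pos_1 : pos 1 by move=> x; rewrite poly_op1; exact: innerxx_ge0.
have pos_X : pos 'X by move=> x; rewrite poly_opX.
have pos_1X : pos (1 - 'X).
  by move=> x; rewrite poly_opB poly_op1 poly_opX innerBl subr_ge0.
have pos_X1X : pos ('X * (1 - 'X)).
  have -> : 'X * (1 - 'X) = 'X^2 * (1 - 'X) + (1 - 'X) ^+ 2 * 'X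
    :> {poly R[i]} by ring.
  by apply: posD; [apply: posX | apply: pos1X].
have step2 (P : nat -> Prop) :
    P 0 -> P 1 -> (forall k, P k -> P k.+2) -> forall k, P k.
  move=> P0 P1 PS k; suff [] : P k /\ P k.+1 by [].
  by elim: k => [//|k [Pk Pk1]]; split=> //; apply: PS.
elim/step2: i => [||i IH].
- rewrite expr0 mul1r; elim/step2: j => [||j IH]; rewrite ?expr0 ?expr1 //.
  by rewrite -addn2 addnC exprD; apply: pos1X.
- rewrite expr1; elim/step2: j => [||j IH]; rewrite ?expr0 ?expr1 ?mulr1 //.
  by rewrite -addn2 addnC exprD mulrCA; apply: pos1X.
- by rewrite -addn2 addnC exprD -mulrA; apply: posX.
Qed.

Lemma bernstein_pos p : B p -> pos p.
Proof.
elim=> [a i j a0|p1 p2 _ IH1 _ IH2] x.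
  by rewrite poly_opZ innerZl mulr_ge0 // bernstein_gen_pos.
by rewrite poly_opD innerDl addr_ge0.
Qed.

Lemma bernstein_sym p : B p -> forall x y, '[op p x, y] = '[x, op p y].
Proof.
elim=> {p} [a i j a0|p1 p2 _ IH1 _ IH2] x y; last first.
  by rewrite !poly_opD innerDl innerDr IH1 IH2.
rewrite !poly_opZ innerZl innerZr geC0_conj //; congr (_ * _).
have symM (p r : {poly R[i]}) : (forall x y, '[op p x, y] = '[x, op p y]) ->
    (forall x y, '[op r x, y] = '[x, op r y]) ->
    forall x y, '[op (p * r) x, y] = '[x, op (p * r) y].
  by move=> sp sr u v; rewrite [in RHS]mulrC !poly_opM sp sr.
have symX (p : {poly R[i]}) k : (forall x y, '[op p x, y] = '[x, op p y]) ->
    forall x y, '[op (p ^+ k) x, y] = '[x, op (p ^+ k) y].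
  move=> sp; elim: k => [|k IH] u v; first by rewrite expr0 !poly_op1.
  by rewrite exprS; apply: symM.
apply: symM; apply: symX => u v; first by rewrite !poly_opX.
by rewrite !poly_opB !poly_op1 !poly_opX innerBl innerBr Qsym.
Qed.

Section InvariantVectors.
Variables (P : bounded_op K K) (m : nat).

Let stable (p : {poly R[i]}) := forall x, P x = x -> P (op p x) = op p x.

Lemma stable_root_approx c k :
  stable 'X^m -> stable (root_approx c%:P 'X m k).
Proof.
move=> sX.
have sM p r : stable p -> stable r -> stable (p * r).
  by move=> sp sr x Px; rewrite poly_opM; apply/sp/sr.
elim: k => [|k IH] x Px /=; first by rewrite poly_opC scale0r linear0.
have sq i : stable (root_approx c%:P 'X m k ^+ i).
  elim: i => [|i IHi]; last by rewrite exprS; apply: sM.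
  by move=> z; rewrite expr0 poly_op1.
by rewrite mul_polyC poly_opD poly_opZ poly_opB linearD linearZ linearB /=
  IH // sX // sq.
Qed.

End InvariantVectors.

(** The fixed vectors of P form a closed subspace, and q_k(Q) preserves it since
q_k is a polynomial in t^(m+1). So for P x = x the defect Q x - P (Q x) is that
of E_k x, where E_k = Q - q_k(Q), and E_k x can be made arbitrarily small. *)
Lemma contraction_root_invariant (P : bounded_op K K) m :
  (forall x, P x = x -> P (iter m.+1 Q x) = iter m.+1 Q x) ->
  forall x, P x = x -> P (Q x) = Q x.
Proof.
move=> invQm x Px.
pose c : {poly R[i]} := (m.+1%:R^-1)%:P.
pose q k := root_approx c 'X m.+1 k; pose E k := 'X - q k.
have cm : c * m.+1%:R = 1 by rewrite /c -polyC_natr -polyCM mulVf ?pnatr_eq0.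
have B0 : B 0 by exact: bernstein_const.
have B1 : B 1 by exact: bernstein_const.
have BD := @Bernstein_add R[i]; have BM := @bernsteinM R[i].
have BX := bernstein_X R[i]; have B1X := bernstein_1BX R[i].
have Bc : B c by apply: bernstein_const; rewrite invr_ge0.
have bounds k := root_approx_bounds B0 B1 BD BM Bc BX B1X cm k.
have BE k : B (E k) by have [] := bounds k.
have B1E k : B (1 - E k).
  have [Bq _ _] := bounds k.
  have -> : 1 - E k = (1 - 'X) + q k by rewrite /E; ring.
  exact: BD.
pose a (p : {poly R[i]}) : R := complex.Re '[op p x, x].
have a_ge0 p : B p -> 0 <= a p.
  by move=> Bp; have := bernstein_pos Bp x; rewrite lecE => /andP[].
have aE p : B p -> '[op p x, x] = (a p)%:C%C.
  by move=> Bp; rewrite RRe_real // ger0_real // bernstein_pos.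
have aD p r : a (p + r) = a p + a r by rewrite /a poly_opD innerDl raddfD.
have aB p r : a (p - r) = a p - a r by rewrite /a poly_opB innerBl raddfB.
have a_nat k p : a (k%:R * p) = k%:R * a p.
  elim: k => [|k IH]; first by rewrite !mul0r /a poly_opC scale0r linear0l.
  by rewrite -addn1 !natrD !mulrDl !mul1r aD IH.
(* The Cauchy-Schwarz inequality for p(Q) x and x. *)
have a_sqr p : B p -> a p ^+ 2 <= a 1 * a (p ^+ 2).
  move=> Bp; rewrite -lecR rmorphXn rmorphM /= -!aE //; last exact: BM.
  rewrite [p ^+ 2]expr2 poly_opM poly_op1.
  have -> : '[op p (op p x), x] = `|op p x| ^+ 2.
    by rewrite bernstein_sym // normr_inner.
  rewrite -normr_inner -exprMn mulrC -(ger0_norm (bernstein_pos Bp x)).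
  by rewrite ler_pXn2r ?nnegrE ?mulr_ge0 // inner_le_norm.
have descent j k : a (E k ^+ j.+1) ^+ 2 <= a 1 * a (E k ^+ j.+2).
  (* E_k^(2j+2) <= E_k^(j+2) because 0 <= E_k <= 1. *)
  apply: le_trans (a_sqr _ (cone_exp B1 BM _ (BE k))) _.
  rewrite ler_wpM2l ?a_ge0 // -subr_ge0 -aB -exprM.
  have -> : E k ^+ j.+2 - E k ^+ (j.+1 * 2) = E k ^+ j.+2 * (1 - E k ^+ j).
    by rewrite mulrBr mulr1 -exprD muln2 -addnn addSn addnS.
  by apply/a_ge0/BM; [apply: cone_exp | apply: cone_1BX].
have a_error k : k%:R * a (E k ^+ m.+1) <= m.+1%:R * a 1.
  rewrite -!a_nat mulr1 -subr_ge0 -aB; apply: a_ge0.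
  exact: root_approx_error.
have [M PM] := op_bounded P.
pose N (y : K) := complex.Re `|y|.
have NE y : `|y| = (N y)%:C%C by rewrite RRe_real // ger0_real.
have N0 y : 0 <= N y by rewrite -ler0c -NE.
have defect k : N (Q x - P (Q x)) <= (1 + `|M|) * N (op (E k) x).
  have -> : Q x - P (Q x) = op (E k) x - P (op (E k) x).
    have sq : P (op (q k) x) = op (q k) x.
      by apply: stable_root_approx => // y Py; rewrite poly_opXn invQm.
    by rewrite poly_opB poly_opX linearB /= sq opprB addrA addrNK.
  rewrite -lecR rmorphM rmorphD /= -!NE mulrDl mul1r.
  apply: le_trans (ler_normB _ _) _; rewrite lerD2l.
  by apply: le_trans (PM _) _; rewrite ler_wpM2r // lecR ler_norm.
have NEk k : N (op (E k) x) ^+ 2 <= a (E k).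
  have -> : N (op (E k) x) ^+ 2 = a (E k ^+ 2).
    apply: complexI; rewrite rmorphXn /= -NE -aE; last exact: BM.
    by rewrite normr_inner expr2 poly_opM (bernstein_sym (BE k) (op (E k) x)).
  rewrite -subr_ge0 -aB; have -> : E k - E k ^+ 2 = E k * (1 - E k) by ring.
  by apply/a_ge0/BM.
suff N_eq0 : N (Q x - P (Q x)) = 0.
  apply/eqP; rewrite eq_sym -subr_eq0 -normr_eq0 NE N_eq0; exact: eqxx.
apply/eqP; rewrite eq_le N0 andbT leNgt; apply/negP => Npos.
set n := N _ in Npos defect; pose L := 1 + `|M|.
have L0 : 0 < L by rewrite /L ltr_pwDl.
have e0 : 0 < (n / L) ^+ 2 / 2 by rewrite divr_gt0 // exprn_gt0 // divr_gt0.
have [k] := vanishing_descent (a_ge0 _ B1) descent a_error e0.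
rewrite expr1 => ak.
have : (n / L) ^+ 2 <= a (E k).
  apply: le_trans (NEk k).
  rewrite ler_pXn2r ?nnegrE ?divr_ge0 ?(ltW L0) ?(ltW Npos) //.
  by rewrite ler_pdivrMr // mulrC defect.
have : 0 < (n / L) ^+ 2 by rewrite exprn_gt0 // divr_gt0.
lra.
Qed.

End PositiveContraction.

(** Rescaling by 1 / (1 + |M|) makes Q a contraction and rescales Q^m by a
nonzero scalar, which does not affect invariance. *)
Lemma positive_root_invariant (R : realType) (K : hilbertType R)
    (Q : {linear K -> K}) (P : bounded_op K K) (M : R) m :
  (forall x y, '[Q x, y] = '[x, Q y]) -> (forall x, 0 <= '[Q x, x]) ->
  (forall x, '[Q x, x] <= M%:C%C * '[x, x]) -> (0 < m)%N ->
  (forall x, P x = x -> P (iter m Q x) = iter m Q x) ->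
  forall x, P x = x -> P (Q x) = Q x.
Proof.
case: m => // m Qsym Q0 QM _ inv x Px.
pose s : R := (1 + `|M|)^-1.
have s0 : 0 < s by rewrite invr_gt0 ltr_pwDl.
have sC0 : 0 <= s%:C%C by rewrite ler0c ltW.
have sN0 : s%:C%C != 0 by rewrite gt_eqF // ltcR.
pose Q' : {linear K -> K} := s%:C%C \*: Q.
have Q'E y : Q' y = s%:C%C *: Q y by [].
have iterE k y : iter k Q' y = s%:C%C ^+ k *: iter k Q y.
  elim: k => [|k IH]; first by rewrite expr0 scale1r.
  by rewrite !iterS Q'E IH linearZ scalerA -exprS.
suff : P (Q' x) = Q' x by rewrite Q'E linearZ => /(scalerI sN0).
apply: (@contraction_root_invariant R K Q' _ _ _ P m _ x Px).
- by move=> y z; rewrite !Q'E innerZl innerZr geC0_conj // Qsym.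
- by move=> y; rewrite Q'E innerZl mulr_ge0.
- move=> y; rewrite Q'E innerZl.
  apply: le_trans (ler_wpM2l sC0 (QM y)) _.
  rewrite mulrA -[leRHS]mul1r ler_wpM2r ?innerxx_ge0 //.
  rewrite -rmorphM /= -[1]/(1%:C%C) lecR mulrC ler_pdivrMr ?ltr_pwDl //.
  by rewrite mul1r (le_trans (ler_norm M)) // lerDr.
- by move=> y Py; rewrite iterE linearZ inv.
Qed.

(** * Subnormal roots of quasinormal operators *)

Section Operators.
Variable R : realType.
Implicit Types H K : hilbertType R.

Lemma adjointPr H K (T : bounded_op H K) x y : '[adjoint T x, y] = '[x, T y].
Proof. by rewrite innerC -adjointP -innerC. Qed.

Lemma inner_injl H (x y : H) : (forall z, '[x, z] = '[y, z]) -> x = y.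
Proof. by move=> xy; apply: inner_injr => z; rewrite innerC xy -innerC. Qed.

Lemma quasinormalP H (A : bounded_op H H) :
  quasinormal A <-> forall x, A (adjoint A (A x)) = adjoint A (A (A x)).
Proof.
split=> [qA x|AA]; last exact: bounded_op_ext.
by have := congr1 (fun S : bounded_op H H => S x) qA.
Qed.

Lemma op_expE H (T : bounded_op H H) n x : op_exp T n x = iter n T x.
Proof. by elim: n => [//|n /= ->]. Qed.

Lemma op_exp_exp H (T : bounded_op H H) m n x :
  op_exp (op_exp T m) n x = iter m (op_exp T n) x.
Proof.
rewrite op_expE.
have iterE k l y : iter k (op_exp T l) y = iter (k * l) T y.
  by elim: k => [//|k IH]; rewrite iterS IH op_expE -iterD mulSn.
by rewrite !iterE mulnC.
Qed.

(** S* commutes with S^n, hence so do the powers of S*, one of which is the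
adjoint of S^n: the operator S^n is normal. *)
Lemma n_normal_exp K (S : bounded_op K K) n : n_normal n S ->
  forall x y, '[op_exp S n x, op_exp S n y] =
              '[adjoint (op_exp S n) x, adjoint (op_exp S n) y].
Proof.
move=> nS x y.
have comm z : adjoint S (op_exp S n z) = op_exp S n (adjoint S z).
  by have := congr1 (fun S : bounded_op K K => S z) nS.
have {}comm k z : adjoint (op_exp S k) (op_exp S n z)
                = op_exp S n (adjoint (op_exp S k) z).
  have adjE j u : adjoint (op_exp S j) u = iter j (adjoint S) u.
    elim: j u => [|j IH] u; apply: inner_injr => w; rewrite -adjointP //.
    by rewrite /= adjointP adjointP IH -iterS iterSr.
  by rewrite !adjE; elim: k => [//|k IH]; rewrite !iterS IH comm.
by rewrite adjointPr -comm -adjointP.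
Qed.

(** N* N commutes with N, so that N*^m N^m = (N* N)^m. *)
Lemma normal_inner_exp K (N : bounded_op K K) m :
  (forall x y, '[N x, N y] = '[adjoint N x, adjoint N y]) ->
  forall x y, '[iter m N x, iter m N y] = '[iter m (adjoint N \o N) x, y].
Proof.
move=> Nnormal.
have comm z : adjoint N (N (N z)) = N (adjoint N (N z)).
  by apply: inner_injl => w; rewrite adjointPr Nnormal -adjointP.
elim: m => [//|m IH] x y.
have commit z : adjoint N (N (iter m N z)) = iter m N (adjoint N (N z)).
  by elim: (m) => [//|k IHk] /=; rewrite comm IHk.
by rewrite !iterS -adjointPr commit IH -iterSr.
Qed.

Lemma isometry_op H K (J : {linear H -> K}) :
  (forall x y, '[J x, J y] = '[x, y]) ->
  exists V : bounded_op H K, V =1 J.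
Proof.
move=> JJ.
suff Jb : exists M : R, forall x, `|J x| <= M%:C%C * `|x|.
  by exists (BoundedOp Jb).
exists 1 => x; rewrite rmorph1 mul1r.
by rewrite -(@ler_pXn2r _ 2) ?nnegrE // !normr_inner JJ.
Qed.

(** The operator P = V V* projects onto the range of V. Equality in
|V* y| <= |y| at y = Q^m V x forces P y = y. *)
Lemma subnormal_root_quasinormal H K (A C : bounded_op H H)
    (N : bounded_op K K) (V : bounded_op H K) m :
  (0 < m)%N ->
  (forall x y, '[N x, N y] = '[adjoint N x, adjoint N y]) ->
  (forall x y, '[V x, V y] = '[x, y]) ->
  (forall x, N (V x) = V (A x)) ->
  (forall x, C x = iter m A x) ->
  quasinormal C -> quasinormal A.
Proof.
move=> m0 Nnormal VV NV CA /quasinormalP qC.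
pose Q : {linear K -> K} := op_comp (adjoint N) N.
have QE x : Q x = adjoint N (N x) by [].
have Qsym x y : '[Q x, y] = '[x, Q y] by rewrite !QE adjointPr adjointP.
have iterQsym k x y : '[iter k Q x, y] = '[x, iter k Q y].
  by elim: k x y => [//|k IH] x y; rewrite iterS Qsym IH -iterSr.
pose V' := adjoint V.
have V'V x : V' (V x) = x by apply: inner_injl => y; rewrite adjointPr VV.
pose P := op_comp V V'.
have PE x : P x = V (V' x) by [].
have VC x : V (C x) = iter m N (V x).
  by rewrite CA; elim: (m) => [//|k IH]; rewrite !iterS -NV IH.
have CCE x : adjoint C (C x) = V' (iter m Q (V x)).
  apply: inner_injl => y.
  by rewrite !adjointPr -VV !VC (normal_inner_exp m Nnormal).
have PQm x : P (iter m Q (V x)) = iter m Q (V x).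
  set y := iter m Q (V x).
  have norm_y : '[y, y] = '[V' y, V' y].
    rewrite [in RHS]/y -CCE adjointPr qC -adjointP -VV !VC -iterD.
    by rewrite (normal_inner_exp _ Nnormal) iterD; apply/esym/iterQsym.
  apply/eqP; rewrite -subr_eq0; apply/eqP/innerxx_eq0.
  rewrite PE innerBl !innerBr VV (adjointP V (V' y)) -(adjointPr V y) norm_y.
  by rewrite !subrr.
have VA x : V (V' (Q (V x))) = Q (V x).
  have [M NM] := op_bounded N.
  apply: (@positive_root_invariant R K Q P (`|M| ^+ 2) m Qsym _ _ m0).
  - by move=> y; rewrite QE adjointPr innerxx_ge0.
  - move=> y; rewrite QE adjointPr -!normr_inner rmorphXn /= -exprMn.
    rewrite ler_pXn2r ?nnegrE ?mulr_ge0 ?ler0c //.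
    by apply: le_trans (NM _) _; rewrite ler_wpM2r // lecR ler_norm.
  - by move=> y <-; rewrite PQm.
  - by rewrite PE V'V.
have AAE x : V (adjoint A (A x)) = Q (V x).
  rewrite -VA; congr (V _); apply: inner_injl => y.
  by rewrite !adjointPr -VV -!NV.
apply/quasinormalP => x.
have : V (A (adjoint A (A x))) = V (adjoint A (A (A x))).
  rewrite AAE -!NV AAE !QE.
  by apply: inner_injl => y; rewrite adjointPr Nnormal -adjointP.
by move/(congr1 V'); rewrite !V'V.
Qed.

End Operators.

Theorem theorem4p9 (R : realType) (H : hilbertType R) (n m : nat)
    (T : bounded_op H H) (n_gt0 : (0 < n)%N) (m_gt1 : (1 < m)%N)
    (subT : sub_n_normal n T) (Tm : n_quasinormal n (op_exp T m)) :
  n_quasinormal n T.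
Proof.
have [K [J [S [JJ nS SJ]]]] := subT.
have [V VJ] := isometry_op JJ.
apply: (@subnormal_root_quasinormal _ H K (op_exp T n)
  (op_exp (op_exp T m) n) (op_exp S n) V m) => //.
- exact: ltnW.
- exact: n_normal_exp.
- by move=> x y; rewrite !VJ.
- move=> x; rewrite !VJ !op_expE.
  by elim: (n) => [//|k IH]; rewrite !iterS IH SJ.
- exact: op_exp_exp.
Qed.
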